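(* Let $l\ge1$. The action of $\widehat{\mathcal{SD}}$ on $\mathfrak F^{\otimes l}$ of central charge $l$, obtained by composing $\widehat\phi_0:\widehat{\mathcal{SD}}\to\widehat{\mathrm{gl}}_{\infty|\infty}$ with the action of $\widehat{\mathrm{gl}}_{\infty|\infty}$ on $\mathfrak F^{\otimes l}$, is given in terms of generating functions $J^{a,n}(z)=\sum_{k\in\mathbb Z}J^{a,n}_kz^{-n-k-1}$ ($a=0,1,\pm$, $n\in\mathbb Z_+$) by $$J^{0,n}(z)=-\sum_{p=1}^l:\psi^{+,p}(z)\,\partial^n\psi^{-,p}(z):,\qquad J^{1,n}(z)=\sum_{p=1}^l:\gamma^{+,p}(z)\,\partial^n\gamma^{-,p}(z):,$$ $$J^{+,n}(z)=-\sum_{p=1}^l:\psi^{+,p}(z)\,\partial^n\gamma^{-,p}(z):,\qquad J^{-,n}(z)=\sum_{p=1}^l:\gamma^{+,p}(z)\,\partial^n\psi^{-,p}(z):,$$ where $\partial^n$ denotes the $n$-th derivative with respect to $z$.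
   Context: $\mathcal{SD}$ is the Lie superalgebra (supercommutator bracket) of the associative superalgebra over $\mathbb C$ generated by even $t^{\pm1}$, $D=t\frac{d}{dt}$ and odd $\theta,\partial_\theta$, with $f(D)t=tf(D+1)$, $\theta^2=\partial_\theta^2=0$, $\theta\partial_\theta+\partial_\theta\theta=1$, $\theta,\partial_\theta$ commuting with $t,D$. Put $M_0=\partial_\theta\theta$, $M_1=\theta\partial_\theta$, $M_+=\partial_\theta$, $M_-=\theta$, $F(D)=\sum_{a=0,1,\pm}f_a(D)M_a$ (similarly $G$). $\widehat{\mathcal{SD}}=\mathcal{SD}\oplus\mathbb CC$, $C$ central, is the central extension by the 2-cocycle $\Psi$ with $\Psi(t^rF(D),t^sG(D))=0$ if $r+s\ne0$ and, for $r=-s\ge0$, $\Psi(t^rF(D),t^{s}G(D))=\sum_{-r\le j\le-1}(f_0(j)g_0(j+r)+f_+(j)g_-(j+r)-f_-(j)g_+(j+r)-f_1(j)g_1(j+r))$, extended by super skew-symmetry. With $[x]_n=x(x-1)\cdots(x-n+1)$, put $J^{a,n}_k=-t^k[D]_nM_a$ ($a=0,1,\pm$, $k\in\mathbb Z$, $n\ge0$); together with $C$ these span $\widehat{\mathcal{SD}}$. $\mathrm{gl}_{\infty|\infty}$: matrices $(a_{ij})_{i,j\in\frac12\mathbb Z}$ with $a_{ij}=0$ for $|i-j|\gg0$, $E_{ij}$ even iff $i-j\in\mathbb Z$. $\widehat{\mathrm{gl}}_{\infty|\infty}=\mathrm{gl}_{\infty|\infty}\oplus\mathbb C\mathbf 1$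 is the central extension by the 2-cocycle $\mathrm{Str}([J,A]B)$, $J=\sum_{r\le0}E_{rr}$, $\mathrm{Str}(c_{ij})=\sum_r(-1)^{2r}c_{rr}$. The homomorphism $\widehat\phi_0$ sends $C\mapsto\mathbf 1$ and $t^kf(D)M_a\mapsto\sum_{j\in\mathbb Z}f(-j)E_{j-k,j}M_a$, where for $i,j\in\mathbb Z$: $E_{ij}M_0=E_{ij}$, $E_{ij}M_1=E_{i-\frac12,j-\frac12}$, $E_{ij}M_+=E_{i,j-\frac12}$, $E_{ij}M_-=E_{i-\frac12,j}$. Fock space: $l$ independent copies ($p=1,\dots,l$) of fermionic fields $\psi^{+,p}(z)=\sum_{n\in\mathbb Z}\psi^{+,p}_nz^{-n-1}$, $\psi^{-,p}(z)=\sum_{n\in\mathbb Z}\psi^{-,p}_nz^{-n}$ with $[\psi^{+,p}_m,\psi^{-,q}_n]_+=\delta_{pq}\delta_{m+n,0}$, and bosonic fields $\gamma^{\pm,p}(z)=\sum_{r\in\frac12+\mathbb Z}\gamma^{\pm,p}_rz^{-r-\frac12}$ with $[\gamma^{+,p}_r,\gamma^{-,q}_s]=\delta_{pq}\delta_{r+s,0}$, all other supercommutators zero. $\mathfrak F^{\otimes l}$ is generated by a vacuum annihilated by $\psi^{+,p}_m,\psi^{-,p}_{m+1}$ ($m\ge0$), $\gamma^{\pm,p}_r$ ($r>0$). Normal ordering moves annihilation operators to the right (with sign for odd operators). $\widehat{\mathrm{gl}}_{\infty|\infty}$ acts with $\mathbf 1\mapsto l$ and, for $i,j\in\mathbb Z$,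 $r,s\in\frac12+\mathbb Z$, $E_{ij}=\sum_p:\psi^{+,p}_{-i}\psi^{-,p}_j:$, $E_{rs}=-\sum_p:\gamma^{+,p}_{-r}\gamma^{-,p}_s:$, $E_{is}=\sum_p:\psi^{+,p}_{-i}\gamma^{-,p}_s:$, $E_{rj}=-\sum_p:\gamma^{+,p}_{-r}\psi^{-,p}_j:$. *)

(* Defs.v *)
From HB Require Import structures.
From mathcomp Require Import all_boot all_order all_algebra.
From mathcomp Require Import boolp classical_sets functions cardinality fsbigop.
From mathcomp Require Import reals.
From mathcomp Require Import complex.

Set Implicit Arguments.
Unset Strict Implicit.
Unset Printing Implicit Defensive.

Import Order.TTheory GRing.Theory Num.Theory.
Local Open Scope classical_set_scope.
Local Open Scope ring_scope.

(* Sums \sum_(i \in A) F i are taken over the support of F in A, with value 0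
   when that support is infinite. *)

(* sb_mem cuts the actual space out of an ambient module of functions;
   sb_part false and sb_part true are the even and the odd component. *)
Record superbracket (K : fieldType) := Superbracket {
  sb_sort : lmodType K;
  sb_mem : sb_sort -> Prop;
  sb_part : bool -> sb_sort -> sb_sort;
  sb_br : sb_sort -> sb_sort -> sb_sort }.

Definition supercommutator (K : fieldType) (V : lmodType K)
    (part : bool -> V -> V) (mul : V -> V -> V) (x y : V) : V :=
  \sum_(p : bool) \sum_(q : bool)
    (mul (part p x) (part q y)
     - (-1) ^+ (p && q) *: mul (part q y) (part p x)).

Definition is_super_hom (K : fieldType) (L L' : superbracket K)
    (f : sb_sort L -> sb_sort L') : Prop :=
  [/\ forall x, sb_mem x -> sb_mem (f x),
      forall c x y, sb_mem x -> sb_mem y -> f (c *: x + y) = c *: f x + f y,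
      forall p x, sb_mem x -> f (sb_part p x) = sb_part p (f x)
    & forall x y, sb_mem x -> sb_mem y -> f (sb_br x y) = sb_br (f x) (f y)].

(* gr b is the component of parity b of the superspace V. *)
Definition is_super_action (K : fieldType) (L : superbracket K)
    (V : lmodType K) (gr : bool -> V -> Prop) (r : sb_sort L -> V -> V) : Prop :=
  [/\ forall x c u v, sb_mem x -> r x (c *: u + v) = c *: r x u + r x v,
      forall c x y v, sb_mem x -> sb_mem y ->
        r (c *: x + y) v = c *: r x v + r y v,
      forall p b x v, sb_mem x -> sb_part p x = x -> gr b v ->
        gr (p (+) b) (r x v)
    & forall p q x y v, sb_mem x -> sb_mem y ->
        sb_part p x = x -> sb_part q y = y ->
        r (sb_br x y) v = r x (r y v) - (-1) ^+ (p && q) *: r y (r x v)].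

(* M_0, M_1, M_+, M_- multiply like the matrix units e_00, e_11, e_01, e_10
   (e.g. M_0 M_+ = M_+ = M_+ M_1 and M_+ M_- = M_0), so each is encoded by its
   pair (row, column). *)
Definition midx : Type := (bool * bool)%type.
Definition M0 : midx := (false, false).
Definition M1 : midx := (true, true).
Definition Mp : midx := (false, true).
Definition Mm : midx := (true, false).

Definition midx_odd (a : midx) : bool := a.1 (+) a.2.

(* x stands for the sum over k and a of t^k (x k a)(D) M_a; the elements
   t^k D^n M_a form a basis of SD, whose elements are the x of finite support. *)
Definition sd (K : fieldType) : lmodType K := int -> midx -> {poly K}.

Definition sd_mem (K : fieldType) (x : sd K) : Prop :=
  finite_set [set k | x k != (0 : midx -> {poly K})].

Definition sdpart (K : fieldType) (p : bool) (F : midx -> {poly K}) :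
    midx -> {poly K} :=
  fun a => if midx_odd a == p then F a else 0.

Definition sd_part (K : fieldType) (p : bool) (x : sd K) : sd K :=
  fun k => sdpart p (x k).

(* t^r F(D) t^s G(D) = t^(r+s) F(D+s) G(D) *)
Definition sd_mul (K : fieldType) (x y : sd K) : sd K :=
  fun n a => \sum_(k \in [set: int]) \sum_(m : bool)
    (x k (a.1, m) \Po ('X + ((n - k)%:~R)%:P)) * y (n - k) (m, a.2).

(* Psi (t^r F(D), t^-r G(D)) for r >= 0; the summation index is j = - i - 1. *)
Definition Psi_nat (K : fieldType) (r : nat) (F G : midx -> {poly K}) : K :=
  \sum_(i < r)
    let f a := (F a).[(- (i.+1)%:Z)%:~R] in
    let g a := (G a).[(- (i.+1)%:Z + r%:Z)%:~R] in
    f M0 * g M0 + f Mp * g Mm - f Mm * g Mp - f M1 * g M1.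

Definition Psi_int (K : fieldType) (r : int) (F G : midx -> {poly K}) : K :=
  match r with
  | Posz n => Psi_nat n F G
  | Negz n => - \sum_(p : bool) \sum_(q : bool)
                (-1) ^+ (p && q) * Psi_nat n.+1 (sdpart q G) (sdpart p F)
  end.

Definition Psi (K : fieldType) (x y : sd K) : K :=
  \sum_(r \in [set: int]) Psi_int r (x r) (y (- r)).

(* (x, c) stands for x + c C. *)
Definition sdhat (K : fieldType) : superbracket K :=
  @Superbracket K (sd K * K^o)%type
    (fun x => sd_mem x.1)
    (fun p x => (sd_part p x.1, if p then 0 else x.2))
    (fun x y => (supercommutator (@sd_part K) (@sd_mul K) x.1 y.1,
                 Psi x.1 y.1)).

Definition sd_mono (K : fieldType) (k : int) (f : {poly K}) (a : midx) : sd K :=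
  fun k' a' => if (k' == k) && (a' == a) then f else 0.

Definition falling (K : fieldType) (n : nat) : {poly K} :=
  \prod_(i < n) ('X - (i%:R)%:P).

Definition Jmode (K : fieldType) (a : midx) (n : nat) (k : int) :
    sb_sort (sdhat K) :=
  (- sd_mono k (falling K n) a, 0).

Definition Ccentral (K : fieldType) : sb_sort (sdhat K) := (0, 1).

(* Throughout, h in (1/2)Z is encoded by the integer 2h: even integers encode
   the elements of Z, odd ones those of 1/2 + Z. *)
Definition hodd (h : int) : bool := odd `|h|%N.

Definition gl (K : fieldType) : lmodType K := int -> int -> K^o.

Definition gl_mem (K : fieldType) (A : gl K) : Prop :=
  exists N : nat, forall a b : int, (N < `|a - b|)%N -> A a b = 0.

Definition gl_part (K : fieldType) (p : bool) (A : gl K) : gl K :=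
  fun a b => if hodd (a - b) == p then A a b else 0.

Definition gl_mul (K : fieldType) (A B : gl K) : gl K :=
  fun a c => \sum_(b \in [set: int]) (A a b * B b c : K).

Definition gl_br (K : fieldType) : gl K -> gl K -> gl K :=
  supercommutator (@gl_part K) (@gl_mul K).

Definition gl_J (K : fieldType) : gl K :=
  fun a b => ((a == b) && (a <= 0))%:R.

Definition Str (K : fieldType) (A : gl K) : K :=
  \sum_(r \in [set: int]) ((-1) ^+ hodd r * A r r : K).

(* (A, c) stands for A + c 1. *)
Definition glhat (K : fieldType) : superbracket K :=
  @Superbracket K (gl K * K^o)%type
    (fun x => gl_mem x.1)
    (fun p x => (gl_part p x.1, if p then 0 else x.2))
    (fun x y => (gl_br x.1 y.1, Str (gl_mul (gl_br (gl_J K) x.1) y.1))).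

(* E_{ij} M_a for i, j in Z: M_a shifts i (resp. j) by -1/2 when its row
   (resp. column) is 1. *)
Definition EM (K : fieldType) (i j : int) (m : midx) : gl K :=
  fun a b => ((a == 2 * i - (m.1 : nat)%:Z) && (b == 2 * j - (m.2 : nat)%:Z))%:R.

Definition phi0 (K : fieldType) (x : sd K) : gl K :=
  fun a b => \sum_(k \in [set: int]) \sum_(m : midx) \sum_(j \in [set: int])
    ((x k m).[(- j)%:~R] * EM K (j - k) j m a b : K).

Definition phi0hat (K : fieldType) (x : sb_sort (sdhat K)) : sb_sort (glhat K) :=
  (phi0 x.1, x.2).

Inductive sgn := Plus | Minus.

(* Osc s p (2 n) is psi^{s,p}_n and, for r in 1/2 + Z, Osc s p (2 r) is
   gamma^{s,p}_r. *)
Record osc (l : nat) := Osc { osc_sgn : sgn; osc_copy : 'I_l; osc_idx : int }.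

Definition osc_odd (l : nat) (x : osc l) : bool := ~~ hodd (osc_idx x).

Definition annihilates (l : nat) (x : osc l) : bool :=
  match osc_sgn x with
  | Plus => if osc_odd x then 0 <= osc_idx x else 0 < osc_idx x
  | Minus => 0 < osc_idx x
  end.

Record fockSpace (K : fieldType) (l : nat) := FockSpace {
  fock_sort : lmodType K;
  fock_op : osc l -> {linear fock_sort -> fock_sort};
  vacuum : fock_sort;
  vacuum_neq0 : vacuum != 0;
  fock_relation : forall (p q : 'I_l) (a b : int) v,
    let x := Osc Plus p a in let y := Osc Minus q b in
    fock_op x (fock_op y v)
    - (-1) ^+ (osc_odd x && osc_odd y) *: fock_op y (fock_op x v)
    = ((p == q) && (a + b == 0))%:R *: v;
  fock_relation0 : forall (s : sgn) (p q : 'I_l) (a b : int) v,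
    let x := Osc s p a in let y := Osc s q b in
    fock_op x (fock_op y v)
    - (-1) ^+ (osc_odd x && osc_odd y) *: fock_op y (fock_op x v) = 0;
  vacuum_annihilated : forall x, annihilates x -> fock_op x vacuum = 0;
  fock_generated : forall P : fock_sort -> Prop,
    P vacuum ->
    (forall c u v, P u -> P v -> P (c *: u + v)) ->
    (forall x v, P v -> P (fock_op x v)) ->
    forall v, P v }.
Arguments fock_op {K l} _ _.
Arguments vacuum {K l} _.

Inductive fock_parity (K : fieldType) (l : nat) (F : fockSpace K l) :
    bool -> fock_sort F -> Prop :=
| fock_parity_vac : fock_parity false (vacuum F)
| fock_parity0 b : fock_parity b 0
| fock_parity_lin b c u v :
    fock_parity b u -> fock_parity b v -> fock_parity b (c *: u + v)
| fock_parity_op b x v :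
    fock_parity b v -> fock_parity (osc_odd x (+) b) (fock_op F x v).
Arguments fock_parity {K l} F b v.

Definition normal_order (K : fieldType) (l : nat) (F : fockSpace K l)
    (x y : osc l) (v : fock_sort F) : fock_sort F :=
  if annihilates x && ~~ annihilates y
  then (-1) ^+ (osc_odd x && osc_odd y) *: fock_op F y (fock_op F x v)
  else fock_op F x (fock_op F y v).
Arguments normal_order {K l} F x y v.

(* The four cases of the action of E_{ab}: the sign is + for a in Z and
   - for a in 1/2 + Z. *)
Definition Eop (K : fieldType) (l : nat) (F : fockSpace K l) (a b : int)
    (v : fock_sort F) : fock_sort F :=
  (-1) ^+ hodd a *:
    \sum_(p < l) normal_order F (Osc Plus p (- a)) (Osc Minus p b) v.
Arguments Eop {K l} F a b v.

Definition gl_action (K : fieldType) (l : nat) (F : fockSpace K l)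
    (x : sb_sort (glhat K)) (v : fock_sort F) : fock_sort F :=
  \sum_(ab \in [set: int * int]) (x.1 ab.1 ab.2 : K) *: Eop F ab.1 ab.2 v
  + ((x.2 : K) * l%:R) *: v.
Arguments gl_action {K l} F x v.

Definition sd_action (K : fieldType) (l : nat) (F : fockSpace K l)
    (x : sb_sort (sdhat K)) : fock_sort F -> fock_sort F :=
  gl_action F (phi0hat x).
Arguments sd_action {K l} F x v.

(* A formal distribution in z whose coefficient at z^e is the scalar
   (f e).1 times the mode (f e).2; the free fields and their derivatives all
   have this form. *)
Definition mode_field (K : fieldType) (l : nat) : Type := int -> K * osc l.

Definition psi_plus {K : fieldType} {l : nat} (p : 'I_l) : mode_field K l :=
  fun e => (1, Osc Plus p (2 * (- e - 1))).
Definition psi_minus {K : fieldType} {l : nat} (p : 'I_l) : mode_field K l :=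
  fun e => (1, Osc Minus p (2 * (- e))).
(* z^e = z^(- r - 1/2) for r = - e - 1/2 *)
Definition gamma_plus {K : fieldType} {l : nat} (p : 'I_l) : mode_field K l :=
  fun e => (1, Osc Plus p (- 2 * e - 1)).
Definition gamma_minus {K : fieldType} {l : nat} (p : 'I_l) : mode_field K l :=
  fun e => (1, Osc Minus p (- 2 * e - 1)).

Definition dz (K : fieldType) (l : nat) (f : mode_field K l) : mode_field K l :=
  fun e => ((e + 1)%:~R * (f (e + 1)).1, (f (e + 1)).2).

Definition dzn (K : fieldType) (l n : nat) (f : mode_field K l) : mode_field K l :=
  iter n (@dz K l) f.

Definition nprod_term (K : fieldType) (l : nat) (F : fockSpace K l)
    (f g : mode_field K l) (m : int) (v : fock_sort F) (e : int) : fock_sort F :=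
  ((f e).1 * (g (m - e)).1) *: normal_order F (f e).2 (g (m - e)).2 v.
Arguments nprod_term {K l} F f g m v e.

(* coefficient of z^m in :f(z) g(z):, applied to v *)
Definition nprod (K : fieldType) (l : nat) (F : fockSpace K l)
    (f g : mode_field K l) (m : int) (v : fock_sort F) : fock_sort F :=
  \sum_(e \in [set: int]) nprod_term F f g m v e.
Arguments nprod {K l} F f g m v.

Definition nprod_wd (K : fieldType) (l : nat) (F : fockSpace K l)
    (f g : mode_field K l) : Prop :=
  forall m v, finite_set [set e | nprod_term F f g m v e != 0].

(* coefficient of z^m in J^{a,n}(z), where m = - n - k - 1 *)
Definition Jfield (K : fieldType) (l : nat) (F : fockSpace K l)
    (a : midx) (n : nat) (m : int) : fock_sort F -> fock_sort F :=
  sd_action F (Jmode K a n (- m - n%:Z - 1)).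
Arguments Jfield {K l} F a n m v.

(* Main.v *)
Require Import Defs.
From HB Require Import structures.
From mathcomp Require Import all_boot all_order all_algebra.
From mathcomp Require Import boolp classical_sets functions cardinality fsbigop.
From mathcomp Require Import reals complex.
From mathcomp Require Import zify ring.

Import GRing.Theory Num.Theory.
Local Open Scope classical_set_scope.
Local Open Scope ring_scope.
Set Implicit Arguments.
Unset Strict Implicit.
Unset Printing Implicit Defensive.

(** The map [phi0] sends t^k f(D) M_a to one diagonal of a matrix over 1/2 Z,
    with the values f(-j) as entries. Splitting an index of 1/2 Z into an
    integer and a parity bit, every entry of [phi0 x] is one value of one
    coefficient of x ([phi0E]). The relation f(D) t = t f(D+1) is then the shift of evaluation
    points along a product of diagonals, so [phi0] is multiplicative
    ([phi0_mul]). In Str([J,A]B) only the entries separated by 0 count; on the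
    r-th diagonal there are |r| of them, and they are the terms of Psi
    ([Psi_Str]).

    On the Fock space, the products of a plus mode and a minus mode, summed over
    the copies and taken without normal ordering, satisfy the relations of the
    matrix units E_ab exactly ([bare_comm]). Normal ordering subtracts from
    E_ab the constant (-1)^(2a) l for a = b <= 0 ([normal_orderE]), that is,
    l Str(J E_ab). On finite matrices these constants add up, on
    a bracket, to l Str(J[A,B]) = l Str([J,A]B); the right-hand side makes sense
    for infinite matrices too, since [J,A] is concentrated near 0, and it is the
    cocycle ([vacuum_trace_br]).

    The passage to infinite matrices is by truncation. Each vector is killed by
    all annihilation modes of large index ([fock_smooth]), so that near the
    diagonal only finitely many normally ordered E_ab act on it
    ([Eop_vanish]). For given vectors, a banded matrix can therefore be replaced
    by its restriction to a large box, where the computation is finite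
    ([gl_action_box], [box_act_comm]); products truncated to the box are wrong
    only at entries that kill the vector ([gl_action_br]).

    The generating functions are compared mode by mode: the n-th derivative of
    z^(-j) has coefficient [-j]_n, which is the entry of [D]_n on the diagonal
    ([nprod_termE], [JfieldE]). *)

(** * Sums with finite support *)

(** Replaces a sum over a finite support by an ordinary iterated sum, in which
    sums can be split and exchanged without finiteness conditions. *)
Lemma fsum_seq (V : nmodType) (T : choiceType) (s : seq T) (G : T -> V) :
  uniq s -> (forall a, a \notin s -> G a = 0) ->
  \sum_(a \in [set: T]) G a = \sum_(a <- s) G a.
Proof.
move=> us G0; rewrite (fsbig_seq _ _ us); symmetry.
by apply: fsbig_widen => // a [_ /= /negP]; exact: G0.
Qed.

Definition box (N : nat) : seq int :=
  [seq i%:Z - N%:Z | i <- iota 0 N.*2.+1].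

Lemma box_uniq N : uniq (box N).
Proof. by rewrite map_inj_uniq ?iota_uniq // => i j; lia. Qed.

Lemma mem_box N (a : int) : (a \in box N) = (`|a| <= N)%N.
Proof.
apply/mapP/idP => [[k] | aN]; first by rewrite mem_iota; lia.
by exists (absz (a + N%:Z)); rewrite ?mem_iota; lia.
Qed.

Lemma fsum_box (V : nmodType) N (G : int -> V) :
  (forall a : int, (N < `|a|)%N -> G a = 0) ->
  \sum_(a \in [set: int]) G a = \sum_(a <- box N) G a.
Proof.
move=> G0; apply: fsum_seq (box_uniq N) _ => a.
by rewrite mem_box -ltnNge; exact: G0.
Qed.

Lemma hoddD (a b : int) : hodd (a + b) = hodd a (+) hodd b.
Proof. by rewrite /hodd; lia. Qed.

Lemma hoddN (a : int) : hodd (- a) = hodd a.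
Proof. by rewrite /hodd abszN. Qed.

(** An index a = 2 j - m of a matrix of gl, with m the bit of M_a, has
    m = hodd a and j = ceil_half a; this splits 1/2 Z into the integer part and
    the parity on which SD acts separately. *)
Definition ceil_half (a : int) : int := ((a + (hodd a : nat)%:Z) %/ 2)%Z.

Lemma hodd_half (j : int) (m : bool) : hodd (2 * j - (m : nat)%:Z) = m.
Proof. by case: m; rewrite /hodd; lia. Qed.

Lemma ceil_halfK (a : int) : 2 * ceil_half a - (hodd a : nat)%:Z = a.
Proof. by rewrite /ceil_half /hodd; case E: (odd _) => /=; lia. Qed.

Lemma ceil_half_half (j : int) (m : bool) :
  ceil_half (2 * j - (m : nat)%:Z) = j.
Proof. by rewrite /ceil_half hodd_half; case: m; lia. Qed.

Lemma ceil_half_le0 (a : int) : (ceil_half a <= 0) = (a <= 0).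
Proof.
by rewrite /ceil_half /hodd; case E: (odd _) => /=; lia.
Qed.

Lemma fsum_half (V : nmodType) (s : seq int) (G : int -> V) :
  uniq s ->
  (forall j (m : bool), j \notin s -> G (2 * j - (m : nat)%:Z) = 0) ->
  \sum_(a \in [set: int]) G a
  = \sum_(j <- s) \sum_(m : bool) G (2 * j - (m : nat)%:Z).
Proof.
move=> us G0.
pose doubled :=
  [seq 2 * j - (nat_of_bool m)%:Z | j <- s, m <- [:: true; false]].
rewrite (fsum_seq (s := doubled)).
- rewrite big_allpairs_dep; apply: eq_bigr => j _.
  by rewrite big_bool !big_cons big_nil /= addr0.
- apply: allpairs_uniq => // -[i m] [j n] _ _ /= e; congr pair.
    by rewrite -(ceil_half_half i m) e ceil_half_half.
  by rewrite -(hodd_half i m) e hodd_half.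
move=> a; rewrite -(ceil_halfK a) => aNs; apply: G0; apply: contra aNs => js.
by apply/allpairsP; exists (ceil_half a, hodd a); split=> //; case: hodd.
Qed.

(** * The homomorphism into infinite matrices *)

Section Phi.
Variable K : fieldType.
Implicit Types x y : sd K.

(** The matrices E_{j-k,j} M_a have their single entry at different places for
    different (k, a, j), so the triple sum has at most one term at (a, b). *)
Lemma phi0E x a b :
  phi0 x a b =
  (x (ceil_half b - ceil_half a) (hodd a, hodd b)).[(- ceil_half b)%:~R].
Proof.
have EMF k j (m : midx) : Defs.EM K (j - k) j m a b =
    ((k == ceil_half b - ceil_half a) && (j == ceil_half b) &&
     (m == (hodd a, hodd b)))%:R.
  congr (_%:R); congr nat_of_bool; case: m => m1 m2 /=.
  apply/andP/andP => [[/eqP -> /eqP ->]|].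
    by rewrite !ceil_half_half !hodd_half; split; rewrite ?eqxx ?andbT //; lia.
  case=> /andP[/eqP -> /eqP ->] /eqP[-> ->].
  by rewrite subKr !ceil_halfK.
rewrite /phi0 (fsum_seq (s := [:: ceil_half b - ceil_half a])) //; last first.
  move=> k; rewrite inE => /negPf kN; apply: big1 => m _; apply: fsbig1 => j _.
  by rewrite EMF kN mulr0.
rewrite big_seq1 (bigD1 (hodd a, hodd b)) //=.
rewrite [X in _ + X]big1 => [|m /negPf mN].
  rewrite addr0 (fsum_seq (s := [:: ceil_half b])) //.
    by rewrite big_seq1 EMF !eqxx mulr1.
  by move=> j; rewrite inE => /negPf jN; rewrite EMF jN andbF mulr0.
by apply: fsbig1 => j _; rewrite EMF mN andbF mulr0.
Qed.

Lemma phi0_lin c x y : phi0 (c *: x + y) = c *: phi0 x + phi0 y.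
Proof.
apply/funext => a; apply/funext => b.
have sE (A B : gl K) : (c *: A + B) a b = c * A a b + B a b by [].
have sE' k m : (c *: x + y) k m = c *: x k m + y k m by [].
by rewrite sE !phi0E sE' !hornerE.
Qed.

Lemma sd_memP x : sd_mem x ->
  exists M : nat, forall k : int, (M < `|k|)%N -> x k = 0.
Proof.
move=> /finite_seqP[s xs]; exists (\max_(k <- s) `|k|%N) => k kM.
apply/eqP; apply: contraTT kM => xk.
have ks : k \in s by move/seteqP: xs => -[/(_ k xk)].
by rewrite -leqNgt (big_rem k ks) /= leq_maxl.
Qed.

Lemma phi0_band x M : (forall k : int, (M < `|k|)%N -> x k = 0) ->
  forall a b : int, (M < `|ceil_half b - ceil_half a|)%N -> phi0 x a b = 0.
Proof. by move=> xM a b ab; rewrite phi0E xM //= horner0. Qed.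

Lemma phi0_mem x : sd_mem x -> gl_mem (phi0 x).
Proof.
move=> /sd_memP[M xM]; exists (2 * M + 1)%N => a b ab.
apply: (phi0_band xM).
have := ceil_halfK a; have := ceil_halfK b.
by case: (hodd a); case: (hodd b) => /=; lia.
Qed.

Lemma phi0_part p x : phi0 (sd_part p x) = gl_part p (phi0 x).
Proof.
apply/funext => a; apply/funext => b.
rewrite /gl_part !phi0E /sd_part /sdpart /midx_odd /= hoddD hoddN.
by case: ifP => // _; rewrite horner0.
Qed.

Lemma sd_part_mem p x : sd_mem x -> sd_mem (sd_part p x).
Proof.
apply: sub_finite_set => k /=; apply: contraNN => /eqP xk; apply/eqP.
by rewrite /sd_part /sdpart xk; apply/funext => a; case: ifP.
Qed.

(** An intermediate index b of the matrix product corresponds to a degree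
    k = ceil_half b - ceil_half a and a bit; the substitution D + (n - k) in
    the product of SD moves the evaluation point from - ceil_half c to
    - ceil_half b, which is where the first factor has to be evaluated. *)
Lemma phi0_mul x y : sd_mem x -> phi0 (sd_mul x y) = gl_mul (phi0 x) (phi0 y).
Proof.
move=> /sd_memP[M xM]; apply/funext => a; apply/funext => c.
rewrite phi0E /sd_mul /gl_mul; set n := ceil_half c - ceil_half a.
rewrite (fsum_box (N := M)) => [|k /xM xk]; last first.
  by apply: big1 => m _; rewrite xk /= comp_poly0 mul0r.
rewrite (fsum_half (s := [seq ceil_half a + k | k <- box M])); first last.
- move=> j m js; rewrite (phi0_band xM) ?mul0r // ceil_half_half ltnNge.
  apply: contra js => jM; apply/mapP; exists (j - ceil_half a).
    by rewrite mem_box.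
  by rewrite addrC subrK.
- by rewrite map_inj_uniq ?box_uniq //; apply: addrI.
rewrite [RHS]big_map horner_sum; apply: eq_bigr => k _.
rewrite horner_sum; apply: eq_bigr => m _.
rewrite !phi0E !ceil_half_half !hodd_half /= hornerM horner_comp !hornerE.
have -> : ceil_half a + k - ceil_half a = k by lia.
have -> : ceil_half c - (ceil_half a + k) = n - k by rewrite /n; lia.
rewrite -rmorphD /=; congr (_.[_%:~R] * _).
by rewrite /n; lia.
Qed.

Lemma phi0_br x y : sd_mem x -> sd_mem y ->
  phi0 (supercommutator (@sd_part K) (@sd_mul K) x y)
  = gl_br (phi0 x) (phi0 y).
Proof.
move=> xm ym.
have phi0D (z t : sd K) : phi0 (z + t) = phi0 z + phi0 t.
  by have := phi0_lin 1 z t; rewrite !scale1r.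
have phi00 : phi0 (0 : sd K) = 0.
  by apply: (addrI (phi0 0)); rewrite -phi0D !addr0.
have phi0Z c (z : sd K) : phi0 (c *: z) = c *: phi0 z.
  by have := phi0_lin c z 0; rewrite phi00 !addr0.
rewrite /gl_br /supercommutator !big_bool /= !phi0D -!scaleNr !phi0Z.
by rewrite !phi0_mul ?phi0_part //; apply: sd_part_mem.
Qed.

End Phi.

(** * Comparison of the two cocycles *)

Section Cocycle.
Variable K : fieldType.
Implicit Types (A B : gl K) (x y : sd K).

(** The commutator with J multiplies the entry (a, b) by this factor, which
    vanishes unless 0 separates a and b. *)
Definition step_diff (a b : int) : K := (a <= 0)%R%:R - (b <= 0)%R%:R.

Lemma gl_mulJl A a b : gl_mul (gl_J K) A a b = (a <= 0)%R%:R * A a b.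
Proof.
rewrite /gl_mul (fsum_seq (s := [:: a])) ?big_seq1 /gl_J ?eqxx //.
by move=> c; rewrite inE eq_sym => /negPf ->; rewrite mul0r.
Qed.

Lemma gl_mulJr A a b : gl_mul A (gl_J K) a b = A a b * (b <= 0)%R%:R.
Proof.
rewrite /gl_mul (fsum_seq (s := [:: b])) ?big_seq1 /gl_J ?eqxx //.
by move=> c; rewrite inE => /negPf ->; rewrite mulr0.
Qed.

Lemma gl_mul0l A : gl_mul 0 A = 0.
Proof.
by apply/funext => a; apply/funext => b; apply: fsbig1 => c _; rewrite mul0r.
Qed.

Lemma gl_mul0r A : gl_mul A 0 = 0.
Proof.
by apply/funext => a; apply/funext => b; apply: fsbig1 => c _; rewrite mulr0.
Qed.

Lemma gl_part_id p q A : gl_part p A = A ->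
  gl_part q A = if q == p then A else 0.
Proof.
move=> pA; case: eqP => [-> // | /eqP qp].
apply/funext => a; apply/funext => b; rewrite -pA /gl_part.
by clear pA; move: qp; case: q; case: p; case: hodd.
Qed.

Lemma gl_part_J : gl_part false (gl_J K) = gl_J K.
Proof.
apply/funext => a; apply/funext => b; rewrite /gl_part /gl_J.
by case: (a =P b) => [->|]; rewrite /= ?subrr // if_same.
Qed.

Lemma gl_part_sum A a b :
  gl_part true A a b + gl_part false A a b = A a b.
Proof. by rewrite /gl_part; case: hodd => /=; rewrite ?addr0 ?add0r. Qed.

Lemma gl_brJ A a b : gl_br (gl_J K) A a b = step_diff a b * A a b.
Proof.
rewrite /gl_br /supercommutator !big_bool /= !(gl_part_id _ gl_part_J) /=.
rewrite !gl_mul0l !gl_mul0r !expr0 expr1 !scale1r scaler0 !subr0 !add0r.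
set A1 := gl_part true A; set A0 := gl_part false A.
have -> : (gl_mul (gl_J K) A1 - gl_mul A1 (gl_J K) +
    (gl_mul (gl_J K) A0 - gl_mul A0 (gl_J K))) a b =
  (gl_mul (gl_J K) A1 a b - gl_mul A1 (gl_J K) a b) +
    (gl_mul (gl_J K) A0 a b - gl_mul A0 (gl_J K) a b) by [].
rewrite !gl_mulJl !gl_mulJr -[A a b]gl_part_sum -/A1 -/A0 /step_diff.
by ring.
Qed.

Lemma StrE A B :
  Str (gl_mul (gl_br (gl_J K) A) B) =
  \sum_(a \in [set: int]) ((-1) ^+ hodd a *
     \sum_(b \in [set: int]) (step_diff a b * A a b * B b a : K) : K).
Proof.
rewrite /Str /gl_mul; apply: eq_fsbigr => a _; congr (_ * _).
by apply: eq_fsbigr => b _; rewrite gl_brJ.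
Qed.

(** On the r-th diagonal the factor is 1 at the r places k <= 0 < k + r, and 0
    elsewhere; this finiteness is what makes the supertrace cocycle converge.
    The places are listed upwards from 1 - r, the order of Psi_nat. *)
Lemma step_sum_nat (r : nat) (h : int -> K) N : (r <= N)%N ->
  \sum_(k <- box N) step_diff k (k + r%:Z) * h k
  = \sum_(k < r) h ((k.+1)%:Z - r%:Z).
Proof.
move=> rN; rewrite -(fsum_box (N := N)); last first.
  move=> k kN; rewrite /step_diff.
  have -> : (k + r%:Z <= 0) = (k <= 0) by lia.
  by rewrite subrr mul0r.
rewrite (fsum_seq (s := [seq k.+1%:Z - r%:Z | k <- iota 0 r])); last first.
- move=> k; have [|kr kN] := boolP ((k <= 0) == (k + r%:Z <= 0)).
    by rewrite /step_diff => /eqP ->; rewrite subrr mul0r.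
  by case/mapP: kN; exists (absz (k + r%:Z - 1)%R); rewrite ?mem_iota; lia.
- by rewrite map_inj_uniq ?iota_uniq // => i j; lia.
rewrite big_map -{1}[r]subn0 big_mkord; apply: eq_bigr => k _.
have -> : step_diff (k.+1%:Z - r%:Z) (k.+1%:Z - r%:Z + r%:Z) = 1; last first.
  by rewrite mul1r.
rewrite /step_diff; have -> : (k.+1%:Z - r%:Z <= 0) by have := ltn_ord k; lia.
have -> : (k.+1%:Z - r%:Z + r%:Z <= 0) = false by lia.
by rewrite subr0.
Qed.

Lemma step_sum_neg (r : nat) (h : int -> K) N : (r <= N)%N ->
  \sum_(k <- box N) step_diff k (k - r%:Z) * h k
  = - \sum_(k < r) h (k.+1)%:Z.
Proof.
move=> rN; rewrite -(fsum_box (N := N)); last first.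
  move=> k kN; rewrite /step_diff.
  have -> : (k - r%:Z <= 0) = (k <= 0) by lia.
  by rewrite subrr mul0r.
rewrite (fsum_seq (s := [seq k.+1%:Z | k <- iota 0 r])); last first.
- move=> k; have [|kr kN] := boolP ((k <= 0) == (k - r%:Z <= 0)).
    by rewrite /step_diff => /eqP ->; rewrite subrr mul0r.
  by case/mapP: kN; exists (absz (k - 1)%R); rewrite ?mem_iota; lia.
- by rewrite map_inj_uniq ?iota_uniq // => i j; lia.
rewrite big_map -{1}[r]subn0 big_mkord -sumrN; apply: eq_bigr => k _.
rewrite /step_diff; have -> : (k.+1%:Z <= 0) = false by lia.
have -> : (k.+1%:Z - r%:Z <= 0) by have := ltn_ord k; lia.
by rewrite sub0r mulN1r.
Qed.

(** The part of the supertrace of a product coming from one pair of 2 x 2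
    blocks, F being evaluated at v and G at u. *)
Definition str_pair (F G : midx -> {poly K}) (u v : K) : K :=
  \sum_(m : bool) \sum_(m' : bool)
    (-1) ^+ m * ((F (m, m')).[v] * (G (m', m)).[u]).

(** For r < 0, super skew-symmetry exchanges F and G, and with them the row and
    the column bit; the sign (-1)^(pq) turns the supertrace weight of one into
    that of the other, since p = q = m + m' and
    (-1)^(m + m') (-1)^m' = (-1)^m. *)
Lemma Psi_intE (r : int) F G N : (`|r| <= N)%N ->
  Psi_int r F G =
  \sum_(k <- box N)
    step_diff k (k + r) * str_pair F G (- k)%:~R (- (k + r))%:~R.
Proof.
case: r => n /= nN.
  rewrite (step_sum_nat _ nN) /Psi_nat; apply: eq_bigr => k _.
  rewrite /str_pair !big_bool /= subrK.
  rewrite -/M1 -/M0 -/Mp -/Mm opprB [_ + n%:Z]addrC expr0 expr1.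
  by ring.
rewrite NegzE (step_sum_neg _ nN) !big_bool /=; congr (- _).
rewrite /Psi_nat !mulr_sumr -!big_split; apply: eq_bigr => k _.
rewrite /str_pair !big_bool /= /sdpart /=.
rewrite opprB [_ + n.+1%:Z]addrC !horner0 !expr0 !expr1.
by ring.
Qed.

(** Summing over the degree r of x and the row i, instead of over rows and
    columns, groups the supertrace by diagonals. All entries that count have
    0 between i and i + r, hence lie in a box of the size of the degrees of
    x. *)
Lemma Psi_Str x y : sd_mem x ->
  Psi x y = Str (gl_mul (gl_br (gl_J K) (phi0 x)) (phi0 y)).
Proof.
move=> /sd_memP[M xM]; rewrite StrE /Psi.
have inner (a : int) : \sum_(b \in [set: int])
    (step_diff a b * phi0 x a b * phi0 y b a : K) =
  \sum_(r <- box M) \sum_(m' : bool)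
     step_diff (ceil_half a) (ceil_half a + r) *
     ((x r (hodd a, m')).[(- (ceil_half a + r))%:~R] *
      (y (- r) (m', hodd a)).[(- ceil_half a)%:~R]).
  rewrite (fsum_half (s := [seq ceil_half a + k | k <- box M])); first last.
  - move=> j m js.
    rewrite (phi0_band xM) ?mulr0 ?mul0r // ceil_half_half ltnNge.
    apply: contra js => jM; apply/mapP; exists (j - ceil_half a).
      by rewrite mem_box.
    by rewrite addrC subrK.
  - by rewrite map_inj_uniq ?box_uniq //; apply: addrI.
  rewrite [LHS]big_map; apply: eq_bigr => r _; apply: eq_bigr => m' _.
  rewrite !phi0E /step_diff -(ceil_half_le0 a) -(ceil_half_le0 (_ - _)).
  rewrite !ceil_half_half !hodd_half -mulrA.
  have -> : ceil_half a + r - ceil_half a = r by lia.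
  by have -> : ceil_half a - (ceil_half a + r) = - r by lia.
transitivity (\sum_(r <- box M) Psi_int r (x r) (y (- r))).
  apply: fsum_box => r /xM ->.
  rewrite (Psi_intE _ _ (leqnn _)); apply: big1 => k _.
  rewrite /str_pair [X in _ * X]big1 ?mulr0 // => m _; apply: big1 => m' _.
  by rewrite horner0 mul0r mulr0.
transitivity (\sum_(r <- box M) \sum_(k <- box M) step_diff k (k + r) *
    str_pair (x r) (y (- r)) (- k)%:~R (- (k + r))%:~R).
  apply: eq_big_seq => r; rewrite mem_box => rM; exact: Psi_intE.
rewrite exchange_big (fsum_half (s := box M)) ?box_uniq //=; last first.
  move=> j m; rewrite mem_box -ltnNge => jM.
  rewrite inner big_seq big1 ?mulr0 //.
  move=> r; rewrite mem_box ceil_half_half => rM; apply: big1 => m' _.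
  rewrite /step_diff; have -> : (j + r <= 0) = (j <= 0) by lia.
  by rewrite subrr mul0r.
apply: eq_bigr => k _.
rewrite (eq_bigr (fun m : bool => \sum_(r <- box M) (-1) ^+ m * \sum_(m' : bool)
   step_diff k (k + r) * ((x r (m, m')).[(- (k + r))%:~R] *
      (y (- r) (m', m)).[(- k)%:~R]))); last first.
  by move=> m _; rewrite inner ceil_half_half hodd_half mulr_sumr.
rewrite [RHS]exchange_big; apply: eq_bigr => r _.
rewrite /str_pair mulr_sumr; apply: eq_bigr => m _.
by rewrite -!mulr_sumr mulrCA.
Qed.

Theorem phi0hat_super_hom : is_super_hom (@phi0hat K).
Proof.
split=> [[x c]|c [x d] [y e] _ _|p [x c] _|[x c] [y d]] /=.
- exact: phi0_mem.
- by rewrite /phi0hat /= phi0_lin.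
- by rewrite /phi0hat /= phi0_part.
by move=> xm ym; rewrite /phi0hat /= phi0_br ?Psi_Str.
Qed.

End Cocycle.

(** * Bilinears in the free fields *)

Section Fock.
Variables (K : fieldType) (l : nat) (F : fockSpace K l).
Local Notation V := (fock_sort F).
Implicit Types (A B : gl K) (u v w : V) (a b c d : int) (p q : 'I_l).

(** The mode of the plus field is negated so that plus_op p a and minus_op q b
    are paired exactly when p = q and a = b, like a basis and its dual basis. *)
Definition plus_op p a : {linear V -> V} := fock_op F (Osc Plus p (- a)).
Definition minus_op p b : {linear V -> V} := fock_op F (Osc Minus p b).

(** Modes with an even index are the fermionic ones. *)
Definition swap_sign a b : K := (-1) ^+ (~~ hodd a && ~~ hodd b).

Lemma swap_sign_sq a b : swap_sign a b * swap_sign a b = 1.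
Proof. by rewrite /swap_sign -signr_addb addbb. Qed.

Lemma plus_minus p q a b v :
  plus_op p a (minus_op q b v) =
  swap_sign a b *: minus_op q b (plus_op p a v)
  + ((p == q) && (a == b))%:R *: v.
Proof.
have := fock_relation p q (- a) b v; rewrite /= /osc_odd /= hoddN.
have -> : (- a + b == 0) = (a == b) by lia.
by move=> <-; rewrite addrC subrK.
Qed.

Lemma minus_plus p q a b v :
  minus_op q b (plus_op p a v) =
  swap_sign a b *: (plus_op p a (minus_op q b v)
                    - ((p == q) && (a == b))%:R *: v).
Proof. by rewrite plus_minus addrK scalerA swap_sign_sq scale1r. Qed.

Lemma plus_plus p q a b v :
  plus_op p a (plus_op q b v) = swap_sign a b *: plus_op q b (plus_op p a v).
Proof.
have := fock_relation0 Plus p q (- a) (- b) v; rewrite /= /osc_odd /= !hoddN.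
by move=> /eqP; rewrite subr_eq0 => /eqP.
Qed.

Lemma minus_minus p q a b v :
  minus_op p a (minus_op q b v) =
  swap_sign a b *: minus_op q b (minus_op p a v).
Proof.
have := fock_relation0 Minus p q a b v; rewrite /= /osc_odd /=.
by move=> /eqP; rewrite subr_eq0 => /eqP.
Qed.

(** Normal ordering exchanges the two modes only for a <= 0 and b <= 0, and
    then discards their contraction, which is nonzero only for a = b. *)
Lemma normal_orderE p a b v :
  normal_order F (Osc Plus p (- a)) (Osc Minus p b) v =
  plus_op p a (minus_op p b v) - ((a == b) && (a <= 0))%:R *: v.
Proof.
rewrite /normal_order /annihilates /osc_odd /= hoddN.
have -> : (if ~~ hodd a then 0 <= - a else 0 < - a) = (a <= 0).
  by rewrite /hodd; case: ifP; lia.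
rewrite -/(plus_op p a) -/(minus_op p b) plus_minus eqxx /=.
have [ab|ab] := eqVneq a b => /=.
  by rewrite ab; case: lerP => //= b0; rewrite ?scale0r ?subr0 ?scale1r ?addrK.
by rewrite scale0r subr0 addr0; case: ifP.
Qed.

(** The operator of E_ab without normal ordering. It satisfies the relations of
    the matrix units exactly; the central charge comes only from the constants
    that normal ordering subtracts. *)
Definition bare_op a b v : V :=
  (-1) ^+ hodd a *: \sum_(p < l) plus_op p a (minus_op p b v).

Lemma Eop_bare a b v :
  Eop F a b v = bare_op a b v
    - ((-1) ^+ hodd a * ((a == b) && (a <= 0))%:R * l%:R) *: v.
Proof.
rewrite /Eop /bare_op; under eq_bigr do rewrite normal_orderE.
rewrite sumrB scalerBr sumr_const card_ord -scaler_nat !scalerA.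
by congr (_ - _ *: _); ring.
Qed.

Lemma bare_op_linear a b : linear (bare_op a b).
Proof.
move=> k u v; rewrite /bare_op.
under eq_bigr do rewrite !linearP.
by rewrite big_split -scaler_sumr /= scalerDr !scalerA mulrC.
Qed.

HB.instance Definition _ a b :=
  GRing.isLinear.Build K V V *:%R (bare_op a b) (bare_op_linear a b).

(** Moving plus_op q c to the left past minus_op p b, and minus_op q d past
    plus_op p a, leaves one contraction each, and exchanging the remaining
    modes gives back the product in the other order. *)
Lemma pair_comm p q a b c d v :
  plus_op p a (minus_op p b (plus_op q c (minus_op q d v)))
  - (-1) ^+ (hodd (a - b) && hodd (c - d)) *:
      plus_op q c (minus_op q d (plus_op p a (minus_op p b v)))
  = ((p == q) && (b == c))%:R *:
      ((-1) ^+ hodd c *: plus_op p a (minus_op q d v))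
  - ((p == q) && (a == d))%:R *:
      ((-1) ^+ (hodd (a - b) && hodd (c - d)) *:
       ((-1) ^+ hodd a *: plus_op q c (minus_op p b v))).
Proof.
rewrite (minus_plus q p c b) linearZ linearB linearZ /=.
rewrite (plus_plus p q a c) (minus_minus p q b d) linearZ linearZ /=.
rewrite (plus_minus p q a d) !(linearD, linearZ) /= eq_sym [c == b]eq_sym.
rewrite /swap_sign !hoddD !hoddN.
move: (plus_op q c (minus_op q d _)) => X.
rewrite !(scalerDr, scalerA, scalerN) -!scaleNr.
(* X is the term without contraction; its two coefficients cancel. *)
have collect (k1 k2 k3 k4 m2 m3 : K) (Y Z : V) :
    k1 + k4 = 0 -> k2 = m2 -> k3 = m3 ->
    k1 *: X + k2 *: Y + k3 *: Z + k4 *: X = m3 *: Z + m2 *: Y.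
  move=> k14 -> ->; rewrite addrC !addrA -scalerDl [k4 + _]addrC k14.
  by rewrite scale0r add0r addrC.
apply: collect.
- by case: (hodd a); case: (hodd b); case: (hodd c); case: (hodd d) => /=; ring.
- have [ad|_] := eqVneq a d; last by rewrite andbF /=; ring.
  rewrite -ad; case: (q == p); case: (hodd a); case: (hodd b);
    by case: (hodd c) => /=; ring.
have [bc|_] := eqVneq b c; last by rewrite andbF /=; ring.
by rewrite -bc; case: (q == p); case: (hodd b) => /=; ring.
Qed.

(** Only equal copies p = q contract, so the double sum over copies in the
    bracket collapses to the single sum of a bilinear. *)
Lemma bare_comm a b c d v :
  bare_op a b (bare_op c d v)
  - (-1) ^+ (hodd (a - b) && hodd (c - d)) *: bare_op c d (bare_op a b v)
  = (b == c)%:R *: bare_op a d v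
    - (a == d)%:R *: ((-1) ^+ (hodd (a - b) && hodd (c - d)) *: bare_op c b v).
Proof.
set s := (-1) ^+ _.
have expand a' b' c' d' : bare_op a' b' (bare_op c' d' v) =
    \sum_(p < l) \sum_(q < l) ((-1) ^+ hodd a' * (-1) ^+ hodd c') *:
      plus_op p a' (minus_op p b' (plus_op q c' (minus_op q d' v))).
  rewrite /bare_op scaler_sumr; apply: eq_bigr => p _.
  rewrite !linear_sum /=; apply: eq_bigr => q _.
  rewrite (linearZ_LR (minus_op p b')) (linearZ_LR (plus_op p a')) /=.
  by rewrite scalerA.
rewrite (expand a) (expand c) [X in s *: X]exchange_big /= scaler_sumr -sumrB.
have term p :
    \sum_(q < l) ((-1) ^+ hodd a * (-1) ^+ hodd c) *:
      plus_op p a (minus_op p b (plus_op q c (minus_op q d v)))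
    - s *: \sum_(q < l) ((-1) ^+ hodd c * (-1) ^+ hodd a) *:
      plus_op q c (minus_op q d (plus_op p a (minus_op p b v)))
    = (b == c)%:R *: ((-1) ^+ hodd a *: plus_op p a (minus_op p d v))
      - (a == d)%:R *: (s *: ((-1) ^+ hodd c *: plus_op p c (minus_op p b v))).
  rewrite scaler_sumr -sumrB.
  have factor (X Y : V) (k k' : K) :
      (k * k') *: X - s *: ((k' * k) *: Y) = (k * k') *: (X - s *: Y).
    by rewrite scalerBr !scalerA [k' * k]mulrC [s * _]mulrC.
  under eq_bigr => q _ do rewrite factor pair_comm -/s.
  rewrite (bigD1 p) //= [X in _ + X]big1 ?addr0 => [|q]; last first.
    by rewrite eq_sym => /negPf ->; rewrite /= !scale0r subr0 scaler0.
  rewrite eqxx /= scalerBr !scalerA; congr (_ *: _ - _ *: _).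
    by rewrite !mulrA [RHS]mulrC -mulrA mulrACA -signr_addb addbb mulr1 mulrC.
  by case: (hodd a); case: (hodd c) => /=; ring.
under eq_bigr => p _ do rewrite term.
by rewrite sumrB /bare_op !scaler_sumr.
Qed.

(** * Smoothness and truncation *)

Lemma fock_op_swap (x y : osc l) v : osc_idx x + osc_idx y != 0 ->
  exists k : K, fock_op F x (fock_op F y v) = k *: fock_op F y (fock_op F x v).
Proof.
have rel0 (k : K) u w : u - k *: w = 0 -> exists k : K, u = k *: w.
  by move=> /eqP; rewrite subr_eq0 => /eqP ->; exists k.
case: x y => [[] p a] [[] q b] /= /negPf ab.
- exact/rel0/fock_relation0.
- have := fock_relation p q a b v; rewrite /= ab andbF scale0r.
  exact: rel0.
- exists ((-1) ^+ (osc_odd (Osc Plus q b) && osc_odd (Osc Minus p a))).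
  have := fock_relation q p b a v; rewrite [b + a]addrC ab andbF scale0r.
  move=> /eqP; rewrite subr_eq0 => /eqP ->.
  by rewrite scalerA -signr_addb addbb scale1r.
exact/rel0/fock_relation0.
Qed.

(** Induction on the generation of v from the vacuum: a mode of index beyond
    that of y has no contraction with y, so it passes y up to a scalar and
    reaches the vacuum. *)
Lemma fock_smooth v : exists N : nat, forall x : osc l,
  annihilates x -> (N < `|osc_idx x|)%N -> fock_op F x v = 0.
Proof.
elim/(@fock_generated _ _ F): v => [|c u v [N uN] [N' vN]|y v [N vN]].
- by exists 0%N => x xa _; exact: vacuum_annihilated.
- exists (maxn N N') => x xa; rewrite gtn_max => /andP[xN xN'].
  by rewrite linearP uN ?vN // scaler0 addr0.
exists (maxn N `|osc_idx y|) => x xa; rewrite gtn_max => /andP[xN xy].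
have [|k ->] := @fock_op_swap x y v; first by lia.
by rewrite vN // linear0 scaler0.
Qed.

(** Near the diagonal a large index makes a and b large with the same sign. If
    positive, minus_op p b annihilates v; if negative, plus_op p a does, and
    normal ordering has put it on the right. *)
Lemma normal_order_vanish M v : exists N : nat, forall p a b,
  (`|a - b| <= M)%N -> (N < maxn `|a| `|b|)%N ->
  normal_order F (Osc Plus p (- a)) (Osc Minus p b) v = 0.
Proof.
have [N vN] := fock_smooth v; exists (N + M)%N => p a b abM abN.
rewrite /normal_order /annihilates /osc_odd /= hoddN.
have -> : (if ~~ hodd a then 0 <= - a else 0 < - a) = (a <= 0).
  by rewrite /hodd; case: ifP; lia.
have [b0|b0] := ltrP 0 b.
  by rewrite andbF (vN (Osc Minus p b)) ?linear0 //=; lia.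
rewrite ifT; last by lia.
rewrite (vN (Osc Plus p (- a))) ?linear0 ?scaler0 //=; last by lia.
by rewrite /annihilates /osc_odd /=; case: ifP => _; lia.
Qed.

Lemma Eop_vanish M v : exists N : nat, forall a b,
  (`|a - b| <= M)%N -> (N < maxn `|a| `|b|)%N -> Eop F a b v = 0.
Proof.
have [N vN] := normal_order_vanish M v; exists N => a b abM abN.
by rewrite /Eop big1 ?scaler0 // => p _; apply: vN.
Qed.

Definition box2 N := [seq (a, b) | a <- box N, b <- box N].

Lemma box2_uniq N : uniq (box2 N).
Proof. by apply: allpairs_uniq; rewrite ?box_uniq // => -[a b] [c d]. Qed.

Lemma mem_box2 N ab : (ab \in box2 N) = (maxn `|ab.1| `|ab.2| <= N)%N.
Proof.
case: ab => a b /=; rewrite geq_max; apply/allpairsP/andP.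
  by case=> -[c d] /= []; rewrite !mem_box => cN dN [-> ->].
by case=> aN bN; exists (a, b); rewrite !mem_box.
Qed.

Lemma gl_support x v : gl_mem x -> exists N : nat, forall a b,
  (N < maxn `|a| `|b|)%N -> x a b *: Eop F a b v = 0.
Proof.
case=> M xM; have [N vN] := Eop_vanish M v; exists N => a b abN.
have [abM|Mab] := leqP `|a - b| M; first by rewrite vN ?scaler0.
by rewrite xM ?scale0r.
Qed.

Lemma gl_action_finite (x : sb_sort (glhat K)) v : sb_mem x ->
  finite_set [set ab | x.1 ab.1 ab.2 *: Eop F ab.1 ab.2 v != 0].
Proof.
move=> /(gl_support v)[N xN]; apply: sub_finite_set (finite_seq (box2 N)).
move=> ab /=; apply: contraNT; rewrite mem_box2 -ltnNge => abN.
by rewrite xN.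
Qed.

Definition box_act N (A : gl K) v : V :=
  \sum_(a <- box N) \sum_(b <- box N) (A a b : K) *: bare_op a b v.

(** The constants subtracted by normal ordering, added up over the diagonal of
    A; it is Str (J A) cut to a box. *)
Definition vacuum_trace N (A : gl K) : K :=
  \sum_(a <- box N) (-1) ^+ hodd a * (a <= 0)%R%:R * (A a a : K).

Lemma box_actE N A v :
  \sum_(a <- box N) \sum_(b <- box N) (A a b : K) *: Eop F a b v
  = box_act N A v - (vacuum_trace N A * l%:R) *: v.
Proof.
rewrite /box_act /vacuum_trace mulr_suml scaler_suml -sumrB.
apply: eq_big_seq => a aN.
under eq_bigr => b _ do rewrite Eop_bare scalerBr.
rewrite sumrB; congr (_ - _).
rewrite (bigD1_seq a) ?box_uniq //= big1 => [|b /negPf ba]; last first.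
  by rewrite eq_sym ba /= mulr0 mul0r scale0r scaler0.
by rewrite addr0 eqxx /= scalerA; congr (_ *: _); ring.
Qed.

(** The infinite sum defining the action is, on a fixed vector, a finite sum of
    bare bilinears plus a scalar, for every sufficiently large box. The box can
    be enlarged freely, so one box serves several vectors at once. *)
Lemma gl_action_box (x : sb_sort (glhat K)) v : sb_mem x ->
  exists N0 : nat, forall N, (N0 <= N)%N ->
  gl_action F x v = box_act N x.1 v + ((x.2 - vacuum_trace N x.1) * l%:R) *: v.
Proof.
move=> /(gl_support v)[N0 xN0]; exists N0 => N N0N.
rewrite /gl_action (fsum_seq (box2_uniq N)); last first.
  move=> ab; rewrite mem_box2 -ltnNge => abN.
  by apply: xN0; exact: leq_ltn_trans abN.
rewrite big_allpairs_dep box_actE -addrA; congr (_ + _).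
by rewrite -scaleNr -scalerDl mulrBl addrC.
Qed.

Lemma box_act_linear N A : linear (box_act N A).
Proof.
move=> k u v; rewrite /box_act scaler_sumr -big_split /=.
apply: eq_bigr => a _; rewrite scaler_sumr -big_split /=.
apply: eq_bigr => b _; rewrite linearP /= scalerDr !scalerA.
by rewrite [A a b * k]mulrC.
Qed.

HB.instance Definition _ N A :=
  GRing.isLinear.Build K V V *:%R (box_act N A) (box_act_linear N A).
Lemma bare_opZ a b (k : K) v : bare_op a b (k *: v) = k *: bare_op a b v.
Proof. exact: (linearZ_LR (bare_op a b)). Qed.

Lemma box_act_box2 N A v :
  box_act N A v = \sum_(k <- box2 N) (A k.1 k.2 : K) *: bare_op k.1 k.2 v.
Proof. by rewrite big_allpairs_dep. Qed.

Definition box_mul N (A B : gl K) : gl K :=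
  fun a c => \sum_(b <- box N) (A a b * B b c : K).

(** A contraction of the inner indices is a matrix product within the box. *)
Lemma box_contract N A B v :
  \sum_(j <- box2 N) \sum_(k <- box2 N)
    (A j.1 j.2 * B k.1 k.2 : K) *: ((j.2 == k.1)%:R *: bare_op j.1 k.2 v)
  = box_act N (box_mul N A B) v.
Proof.
rewrite big_allpairs_dep; apply: eq_bigr => a _ /=.
rewrite (eq_big_seq (fun b => \sum_(c <- box N)
    (A a b * B b c : K) *: bare_op a c v)) => [|b bN].
  by rewrite exchange_big /=; apply: eq_bigr => c _; rewrite -scaler_suml.
rewrite big_allpairs_dep (bigD1_seq b) ?box_uniq //= [X in _ + X]big1 ?addr0.
  by apply: eq_bigr => c _; rewrite eqxx scale1r.
move=> b' /negPf b'b; apply: big1 => c _.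
by rewrite eq_sym b'b scale0r scaler0.
Qed.

Lemma gl_part_neq0 r (A : gl K) a b :
  gl_part r A = A -> A a b != 0 -> hodd (a - b) = r.
Proof.
by move=> <-; rewrite /gl_part; case: ifP => [/eqP //| _]; rewrite eqxx.
Qed.

(** Within a box the bare bilinears represent the associative supercommutator,
    with products truncated to the box, and no central term. *)
Lemma box_act_comm N r s A B v : gl_part r A = A -> gl_part s B = B ->
  box_act N A (box_act N B v) - (-1) ^+ (r && s) *: box_act N B (box_act N A v)
  = box_act N (box_mul N A B - (-1) ^+ (r && s) *: box_mul N B A) v.
Proof.
move=> rA sB; set e := (-1) ^+ (r && s).
have expand (C D : gl K) : box_act N C (box_act N D v) =
    \sum_(j <- box2 N) \sum_(k <- box2 N) (C j.1 j.2 * D k.1 k.2 : K) *: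
      bare_op j.1 j.2 (bare_op k.1 k.2 v).
  rewrite box_act_box2; apply: eq_bigr => j _.
  rewrite box_act_box2 linear_sum /= scaler_sumr; apply: eq_bigr => k _.
  by rewrite bare_opZ scalerA.
have -> : box_act N (box_mul N A B - e *: box_mul N B A) v =
    box_act N (box_mul N A B) v - e *: box_act N (box_mul N B A) v.
  rewrite !box_act_box2 scaler_sumr -sumrB; apply: eq_bigr => k _.
  have combine (X : V) (m n : K) : m *: X - e *: (n *: X) = (m - e * n) *: X.
    by rewrite scalerA -scalerBl.
  by rewrite combine.
rewrite !expand -!box_contract [X in e *: X]exchange_big.
rewrite [X in _ = _ - e *: X]exchange_big /=.
rewrite !scaler_sumr -!sumrB; apply: eq_bigr => j _.
rewrite !scaler_sumr -!sumrB; apply: eq_bigr => k _.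
have [Aj0|Aj] := eqVneq (A j.1 j.2) 0.
  by rewrite Aj0 !mul0r !mulr0 !scale0r.
have [Bk0|Bk] := eqVneq (B k.1 k.2) 0.
  by rewrite Bk0 !mul0r !mulr0 !scale0r.
have := bare_comm j.1 j.2 k.1 k.2 v.
rewrite (gl_part_neq0 rA Aj) (gl_part_neq0 sB Bk) -/e => comm.
have swap (X : V) :
    e *: ((B k.1 k.2 * A j.1 j.2 : K) *: X) =
    (A j.1 j.2 * B k.1 k.2) *: (e *: X).
  by rewrite !scalerA; congr (_ *: _); ring.
rewrite !swap -!scalerBr comm [k.2 == j.1]eq_sym.
congr (_ *: (_ - _)); move: (bare_op k.1 j.2 v) => Y.
by rewrite !scalerA mulrC.
Qed.

Definition banded (M : nat) (A : gl K) : Prop :=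
  forall a b : int, (M < `|a - b|)%N -> A a b = 0.

Lemma box_mul_band M N A B : banded M A -> banded M B ->
  banded (M + M) (box_mul N A B).
Proof.
move=> AM BM a c ac; apply: big1 => b _.
have [abM|Mab] := leqP `|a - b| M; last by rewrite AM ?mul0r.
by rewrite BM ?mulr0 //; lia.
Qed.

Lemma gl_mul_band M A B : banded M A -> banded M B ->
  banded (M + M) (gl_mul A B).
Proof.
move=> AM BM a c ac; apply: fsbig1 => b _.
have [abM|Mab] := leqP `|a - b| M; last by rewrite AM ?mul0r.
by rewrite BM ?mulr0 //; lia.
Qed.

Lemma gl_mul_box M N A B a c : banded M A -> (`|a| + M <= N)%N ->
  gl_mul A B a c = box_mul N A B a c.
Proof.
by move=> AM aN; apply: fsum_box => b bN; rewrite AM ?mul0r //; lia.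
Qed.

Lemma gl_br_homog r s A B : gl_part r A = A -> gl_part s B = B ->
  gl_br A B = gl_mul A B - (-1) ^+ (r && s) *: gl_mul B A.
Proof.
move=> rA sB; rewrite /gl_br /supercommutator !big_bool /=.
rewrite !(gl_part_id _ rA) !(gl_part_id _ sB).
case: r {rA}; case: s {sB} => /=;
  by rewrite !(gl_mul0l, gl_mul0r, scaler0, oppr0, addr0, add0r).
Qed.

(** The supertrace of a supercommutator would vanish, but J A is cut at 0: a
    pair of entries (a, b), (b, a) contributes once for a <= 0 and once, with
    the opposite sign, for b <= 0, so that exactly the pairs separated by 0
    survive. This is the cocycle. *)
Lemma vacuum_trace_br M N r s A B :
  gl_part r A = A -> gl_part s B = B -> banded M A -> (M <= N)%N ->
  vacuum_trace N (box_mul N A B - (-1) ^+ (r && s) *: box_mul N B A)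
  = Str (gl_mul (gl_br (gl_J K) A) B).
Proof.
move=> rA sB AM MN; set e := (-1) ^+ (r && s); rewrite StrE.
have step0 (a b : int) : (N < maxn `|a| `|b|)%N -> step_diff K a b * A a b = 0.
  move=> abN; have [abM|Mab] := leqP `|a - b| M; last by rewrite AM ?mulr0.
  rewrite /step_diff; have -> : (a <= 0) = (b <= 0) by lia.
  by rewrite subrr mul0r.
rewrite (fsum_box (N := N)) => [|a aN]; last first.
  rewrite fsbig1 ?mulr0 // => b _; rewrite step0 ?mul0r //.
  by rewrite leq_max aN.
transitivity (\sum_(a <- box N) \sum_(b <- box N)
   ((-1) ^+ hodd a * (a <= 0)%R%:R * (A a b * B b a) : K)
  - \sum_(a <- box N) \sum_(b <- box N)
   (e * ((-1) ^+ hodd b * (b <= 0)%R%:R * (A a b * B b a)) : K)).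
  rewrite [X in _ = _ - X]exchange_big -sumrB; apply: eq_bigr => a _ /=.
  rewrite -!mulr_sumr mulrCA -mulrBr; congr (_ * _).
  have -> : (box_mul N A B - e *: box_mul N B A) a a =
    box_mul N A B a a - e * box_mul N B A a a by [].
  by congr (_ - _ * _); apply: eq_bigr => b _; rewrite mulrC.
rewrite -sumrB; apply: eq_bigr => a _.
rewrite (fsum_box (N := N)) => [|b bN]; last first.
  by rewrite step0 ?mul0r // leq_max bN orbT.
rewrite mulr_sumr -sumrB; apply: eq_bigr => b _.
have [A0|Aab] := eqVneq (A a b) 0; first by rewrite A0 !(mul0r, mulr0) subrr.
have [B0|Bba] := eqVneq (B b a) 0; first by rewrite B0 !(mul0r, mulr0) subrr.
have := gl_part_neq0 rA Aab; have := gl_part_neq0 sB Bba.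
rewrite /step_diff /e !hoddD !hoddN => <- <-.
by case: (hodd a); case: (hodd b) => /=; ring.
Qed.

Lemma vacuum_trace_odd N A : gl_part true A = A -> vacuum_trace N A = 0.
Proof.
move=> oA; apply: big1 => a _.
by rewrite -oA /gl_part subrr /= mulr0.
Qed.
Lemma box_actD N A u v : box_act N A (u + v) = box_act N A u + box_act N A v.
Proof. exact: (linearD (box_act N A)). Qed.

Lemma box_actZ N A (k : K) v : box_act N A (k *: v) = k *: box_act N A v.
Proof. exact: (linearZ_LR (box_act N A)). Qed.

(** * The action of infinite matrices on the Fock space *)

Lemma gl_br_mem r s A B : gl_part r A = A -> gl_part s B = B ->
  gl_mem A -> gl_mem B -> gl_mem (gl_br A B).
Proof.
move=> rA sB [M AM] [M' BM']; exists (maxn M M' + maxn M M')%N => a b ab.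
have {}AM : banded (maxn M M') A.
  by move=> c d cd; apply: AM; apply: leq_ltn_trans cd; apply: leq_maxl.
have {BM'}BM : banded (maxn M M') B.
  by move=> c d cd; apply: BM'; apply: leq_ltn_trans cd; apply: leq_maxr.
rewrite (gl_br_homog rA sB).
have -> : (gl_mul A B - (-1) ^+ (r && s) *: gl_mul B A) a b =
  gl_mul A B a b - (-1) ^+ (r && s) * gl_mul B A a b by [].
by rewrite (gl_mul_band AM BM) ?(gl_mul_band BM AM) // mulr0 subr0.
Qed.

(** In one large box, the scalar parts of x and y vanish for odd elements, so
    they drop out of the supercommutator, the bare parts give the bracket
    truncated to the box, and the difference of the vacuum traces is the cocycle. *)
Lemma gl_action_br (x y : sb_sort (glhat K)) r s v :
  sb_mem x -> sb_mem y -> sb_part r x = x -> sb_part s y = y ->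
  gl_action F (sb_br x y) v =
  gl_action F x (gl_action F y v)
  - (-1) ^+ (r && s) *: gl_action F y (gl_action F x v).
Proof.
case: x y => [A kA] [B kB]; set x := (A, kA); set y := (B, kB).
move=> xm ym xr ys.
have [rA kA0] : gl_part r A = A /\ (r -> kA = 0).
  by case: xr => rA kE; split=> // rT; rewrite -kE rT.
have [sB kB0] : gl_part s B = B /\ (s -> kB = 0).
  by case: ys => sB kE; split=> // sT; rewrite -kE sT.
have brm : gl_mem (gl_br A B) by apply: (gl_br_mem rA sB).
have [M1 AM1] := xm; have [M2 BM2] := ym; pose M := maxn M1 M2.
have AM : banded M A.
  by move=> c d cd; apply: AM1; apply: leq_ltn_trans cd; apply: leq_maxl.
have BM : banded M B.
  by move=> c d cd; apply: BM2; apply: leq_ltn_trans cd; apply: leq_maxr.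
have [N1 xv] := gl_action_box v xm.
have [N2 yv] := gl_action_box v ym.
have [N3 xyv] := gl_action_box (gl_action F y v) xm.
have [N4 yxv] := gl_action_box (gl_action F x v) ym.
have [N5 brv] := @gl_action_box (@sb_br _ (glhat K) x y) v brm.
have [N6 vN6] := Eop_vanish (M + M) v.
(* The margin M makes truncated products exact at the entries in the box of
   size N6; near-diagonal entries outside that box kill v. *)
pose N := (N1 + N2 + N3 + N4 + N5 + N6 + M)%N.
set e := (-1) ^+ (r && s); pose C := box_mul N A B - e *: box_mul N B A.
have brE :
    \sum_(a <- box N) \sum_(b <- box N) (gl_br A B a b : K) *: Eop F a b v
    = \sum_(a <- box N) \sum_(b <- box N) (C a b : K) *: Eop F a b v.
  apply: eq_big_seq => a _; apply: eq_big_seq => b _.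
  have CE : C a b = box_mul N A B a b - e * box_mul N B A a b by [].
  have BE : gl_br A B a b = gl_mul A B a b - e * gl_mul B A a b.
    by rewrite (gl_br_homog rA sB).
  have [abM|Mab] := leqP `|a - b| (M + M); last first.
    rewrite CE BE (gl_mul_band AM BM) ?(gl_mul_band BM AM) //.
    by rewrite (box_mul_band _ AM BM) ?(box_mul_band _ BM AM).
  have [abN|Nab] := leqP (maxn `|a| `|b|) N6; last by rewrite vN6 ?scaler0.
  have aN : (`|a| + M <= N)%N by move: abN; rewrite geq_max /N; lia.
  by rewrite CE BE (gl_mul_box B b AM aN) (gl_mul_box A b BM aN).
rewrite {}(brv N) /=; last by rewrite /N; lia.
have {}brE : box_act N (gl_br A B) v = box_act N C v
    + ((vacuum_trace N (gl_br A B) - vacuum_trace N C) * l%:R) *: v.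
  move/eqP: brE; rewrite !box_actE subr_eq => /eqP ->.
  by rewrite -addrA mulrBl scalerBl [- _ + _]addrC.
have MN : (M <= N)%N by rewrite /N; lia.
rewrite {}brE -(vacuum_trace_br rA sB AM MN) -/e -/C -addrA -scalerDl.
set t := vacuum_trace N (gl_br A B); set t' := vacuum_trace N C.
have -> : (t - t') * l%:R + (t' - t) * l%:R = 0 :> K by ring.
rewrite scale0r addr0.
rewrite (xyv N) ?(yxv N) ?(xv N) ?(yv N); try by rewrite /N; lia.
rewrite /= -(box_act_comm N v rA sB) -/e.
set gA := (kA - _) * _; set gB := (kB - _) * _.
have gA0 : r -> gA = 0.
  move=> rT; rewrite /gA kA0 // vacuum_trace_odd ?subr0 ?mul0r //.
  by rewrite rT in rA.
have gB0 : s -> gB = 0.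
  move=> sT; rewrite /gB kB0 // vacuum_trace_odd ?subr0 ?mul0r //.
  by rewrite sT in sB.
have eA : e * gA = gA.
  by rewrite /e; case: (r) gA0 => [->|] //; rewrite ?mulr0 ?mul1r.
have eB : e * gB = gB.
  rewrite /e andbC; case: (s) gB0 => [->|] //; rewrite ?mulr0 ?mul1r //.
rewrite !box_actD !box_actZ !scalerDr !scalerA eA eB [e * (_ * _)]mulrA.
(* P and Q are a scalar of one element times the bare part of the other. *)
have cancel_cross (X Y P Q W : V) :
    X - Y = X + P + (Q + W) - (Y + Q + (P + W)).
  by rewrite -(addrA X) -(addrA Y) (addrCA Q P) opprD addrACA subrr addr0.
by rewrite eB [gB * gA]mulrC -cancel_cross.
Qed.

Lemma parityZ r (k : K) v : fock_parity F r v -> fock_parity F r (k *: v).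
Proof.
move=> rv; rewrite -[k *: v]addr0.
by apply: fock_parity_lin rv _; apply: fock_parity0.
Qed.

Lemma parityD r u v :
  fock_parity F r u -> fock_parity F r v -> fock_parity F r (u + v).
Proof. by move=> ru rv; rewrite -[u]scale1r; apply: fock_parity_lin. Qed.

Lemma parity_sum r (I : eqType) (s : seq I) (f : I -> V) :
  (forall i, i \in s -> fock_parity F r (f i)) ->
  fock_parity F r (\sum_(i <- s) f i).
Proof.
move=> rf; rewrite big_seq; elim/big_ind: _ => // [|u v].
  exact: fock_parity0.
exact: parityD.
Qed.

Lemma parity_bare r a b v :
  fock_parity F r v -> fock_parity F (hodd (a - b) (+) r) (bare_op a b v).
Proof.
move=> rv; apply/parityZ/parity_sum => p _.
have -> : hodd (a - b) (+) r =
    osc_odd (Osc Plus p (- a)) (+) (osc_odd (Osc Minus p b) (+) r).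
  by rewrite /osc_odd /= hoddD !hoddN; case: hodd; case: hodd; case: r {rv}.
by do 2!apply: fock_parity_op.
Qed.

Lemma gl_action_parity (x : sb_sort (glhat K)) r s v : sb_mem x ->
  sb_part r x = x -> fock_parity F s v ->
  fock_parity F (r (+) s) (gl_action F x v).
Proof.
move=> xm xr sv; have [N xE] := gl_action_box v xm.
rewrite (xE N (leqnn N)) {xE}.
case: x xm xr => A k /= Am [rA kE]; apply: parityD.
  apply: parity_sum => a _; apply: parity_sum => b _.
  have [->|Aab] := eqVneq (A a b) 0.
    by rewrite scale0r; exact: fock_parity0.
  by rewrite -(gl_part_neq0 rA Aab); apply/parityZ/parity_bare.
case: r rA kE => rA kE; last exact: parityZ.
by rewrite -kE vacuum_trace_odd // subrr mul0r scale0r; exact: fock_parity0.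
Qed.

Lemma gl_action_linear (x : sb_sort (glhat K)) k u v : sb_mem x ->
  gl_action F x (k *: u + v) = k *: gl_action F x u + gl_action F x v.
Proof.
move=> xm; have [N1 xu] := gl_action_box u xm.
have [N2 xv] := gl_action_box v xm.
have [N3 xuv] := gl_action_box (k *: u + v) xm.
rewrite (xu (N1 + N2 + N3)%N) ?(xv (N1 + N2 + N3)%N) ?(xuv (N1 + N2 + N3)%N);
  try lia.
rewrite box_actD box_actZ !scalerDr addrACA; congr (_ + (_ + _)).
by rewrite !scalerA mulrC.
Qed.

Lemma gl_action_linearl (x y : sb_sort (glhat K)) k v : sb_mem x -> sb_mem y ->
  gl_action F (k *: x + y) v = k *: gl_action F x v + gl_action F y v.
Proof.
move=> xm ym; have [N1 xv] := gl_support v xm; have [N2 yv] := gl_support v ym.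
have big0 a b : (N1 + N2 < maxn `|a| `|b|)%N ->
    x.1 a b *: Eop F a b v = 0 /\ y.1 a b *: Eop F a b v = 0.
  by move=> abN; split; [apply: xv | apply: yv]; lia.
have addE a b : (k *: x + y).1 a b = k * x.1 a b + y.1 a b by [].
have outside ab : ab \notin box2 (N1 + N2) ->
    x.1 ab.1 ab.2 *: Eop F ab.1 ab.2 v = 0 /\
    y.1 ab.1 ab.2 *: Eop F ab.1 ab.2 v = 0.
  by rewrite mem_box2 -ltnNge; exact: big0.
rewrite /gl_action !(fsum_seq (box2_uniq (N1 + N2))); last first.
- move=> ab /outside[x0 y0]; rewrite addE scalerDl y0 addr0.
  by rewrite -scalerA x0 scaler0.
- by move=> ab /outside[].
- by move=> ab /outside[].
rewrite scalerDr addrACA scaler_sumr -big_split; congr (_ + _).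
  by apply: eq_bigr => ab _; rewrite addE scalerDl -scalerA.
by rewrite scalerA -scalerDl mulrA -mulrDl.
Qed.

Theorem gl_action_super : is_super_action (fock_parity F) (gl_action F).
Proof.
split=> *; [exact: gl_action_linear | exact: gl_action_linearl
  | exact: gl_action_parity | exact: gl_action_br].
Qed.

End Fock.

(** * Generating fields *)

Lemma super_action_comp (K : fieldType) (L L' : superbracket K)
    (f : sb_sort L -> sb_sort L')
    (W : lmodType K) (gr : bool -> W -> Prop) (r : sb_sort L' -> W -> W) :
  is_super_hom f -> is_super_action gr r ->
  is_super_action gr (fun x => r (f x)).
Proof.
case=> fmem flin fpart fbr [r_lin r_linl r_par r_br]; split.
- by move=> x c u v /fmem; apply: r_lin.
- by move=> c x y v xm ym; rewrite flin // r_linl //; apply: fmem.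
- move=> q b x v xm xq; apply: r_par; first exact: fmem.
  by rewrite -fpart ?xq.
move=> q s x y v xm ym xq ys; rewrite fbr //.
by apply: r_br; rewrite -?fpart ?xq ?ys //; apply: fmem.
Qed.

Section Fields.
Variables (K : fieldType) (l : nat) (F : fockSpace K l).
Local Notation V := (fock_sort F).
Implicit Types (v : V) (p : 'I_l).

Lemma sd_action_super : is_super_action (fock_parity F) (sd_action F).
Proof. exact: super_action_comp (phi0hat_super_hom K) (gl_action_super F). Qed.

Lemma sd_action_central v : sd_action F (Ccentral K) v = l%:R *: v.
Proof.
rewrite /sd_action /gl_action fsbig1 => [|ab _]; first by rewrite add0r mul1r.
by rewrite /= phi0E horner0 scale0r.
Qed.

(** The fields are indexed by the row bit m1 and the column bit m2 of M_a, so
    that the four formulas become one. *)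
Definition plus_field (m1 : bool) p : mode_field K l :=
  if m1 then gamma_plus p else psi_plus p.
Definition minus_field (m2 : bool) p : mode_field K l :=
  if m2 then gamma_minus p else psi_minus p.

Lemma plus_fieldE (m1 : bool) p e :
  plus_field m1 p e = (1, Osc Plus p (- (2 * (e + 1) - (m1 : nat)%:Z))).
Proof.
by case: m1; rewrite /= /gamma_plus /psi_plus; congr pair; congr Osc; lia.
Qed.

Lemma minus_fieldE (m2 : bool) p e :
  minus_field m2 p e = (1, Osc Minus p (2 * - e - (m2 : nat)%:Z)).
Proof.
by case: m2; rewrite /= /gamma_minus /psi_minus; congr pair; congr Osc; lia.
Qed.

Lemma dznE n (f : mode_field K l) (e : int) :
  dzn n f e = ((\prod_(k < n) (e + 1 + k%:Z)%:~R) * (f (e + n%:Z)).1,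
               (f (e + n%:Z)).2).
Proof.
elim: n e => [|n IHn] e.
  have -> : e + 0%:Z = e by lia.
  by rewrite big_ord0 mul1r /dzn /=; case: (f e).
have -> : dzn n.+1 f e = dz (dzn n f) e by [].
rewrite /dz IHn /=; have -> : e + 1 + n%:Z = e + n.+1%:Z by lia.
congr (_, _); rewrite mulrA big_ord_recl; congr (_%:~R * _ * _).
  by rewrite /=; lia.
by apply: eq_bigr => k _; congr (_%:~R); rewrite /= /bump /=; lia.
Qed.

(** The product is written in the order in which the derivatives of z^(-j)
    produce its factors, starting from the last derivative. *)
Lemma falling_horner n (j : int) :
  (falling K n).[(- j)%:~R] = \prod_(k < n) (- j - n%:Z + 1 + k%:Z)%:~R.
Proof.
rewrite /falling horner_prod (reindex_inj rev_ord_inj) /=.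
apply: eq_bigr => k _; rewrite hornerXsubC -[(n - k.+1)%:R]/((n - k.+1)%:Z%:~R).
by rewrite -rmorphB; congr (_%:~R); have := ltn_ord k; lia.
Qed.

(** The contribution of the j-th entry of the diagonal k = - m - n - 1. *)
Definition mode_term (m1 m2 : bool) n (m : int) p v (j : int) : V :=
  (falling K n).[(- j)%:~R] *:
    normal_order F (Osc Plus p (- (2 * (j + m + n%:Z + 1) - (m1 : nat)%:Z)))
      (Osc Minus p (2 * j - (m2 : nat)%:Z)) v.

(** The mode of the minus field at z^(-j) is differentiated to
    [-j]_n z^(-j-n); for the total degree m the plus field then contributes
    at z^(j+m+n), that is, with index j - k for k = - m - n - 1. *)
Lemma nprod_termE (m1 m2 : bool) n (m : int) p v (j : int) :
  nprod_term F (plus_field m1 p) (dzn n (minus_field m2 p)) m v (j + m + n%:Z)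
  = mode_term m1 m2 n m p v j.
Proof.
rewrite /nprod_term /mode_term dznE plus_fieldE minus_fieldE /= mul1r mulr1.
rewrite falling_horner.
have -> : 2 * - (m - (j + m + n%:Z) + n%:Z) = 2 * j by lia.
congr (_ *: _); apply: eq_bigr => k _; congr (_%:~R); lia.
Qed.

Lemma mode_term_support (m1 m2 : bool) n (m : int) v :
  exists N : nat, forall p (j : int), (N < `|j|)%N ->
  normal_order F (Osc Plus p (- (2 * (j + m + n%:Z + 1) - (m1 : nat)%:Z)))
      (Osc Minus p (2 * j - (m2 : nat)%:Z)) v = 0.
Proof.
have [N vN] := normal_order_vanish (2 * (`|m| + n + 2))%N v.
by exists (N + 1)%N => p j jN; apply: vN; case: m1; case: m2 => /=; lia.
Qed.

Lemma nprod_wd_fields (m1 m2 : bool) n p :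
  nprod_wd F (plus_field m1 p) (dzn n (minus_field m2 p)).
Proof.
move=> m v; have [N vN] := mode_term_support m1 m2 n m v.
pose support := [seq j + m + n%:Z | j <- box N].
apply: sub_finite_set (finite_seq support) => e /=.
have -> : e = e - m - n%:Z + m + n%:Z by lia.
rewrite nprod_termE /mode_term; apply: contraNT => eN.
rewrite vN ?scaler0 // ltnNge -mem_box; apply: contra eN => eN.
by apply/mapP; exists (e - m - n%:Z).
Qed.

(** t^k [D]_n M_a fills a single diagonal, and its coefficients [-j]_n are those
    of an n-th derivative of z^(-j). *)
Lemma phi0_Jmode (m1 m2 : bool) n k a b :
  phi0 (Jmode K (m1, m2) n k).1 a b =
  if (a == 2 * (ceil_half b - k) - (m1 : nat)%:Z)
     && (b == 2 * ceil_half b - (m2 : nat)%:Z)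
  then - (falling K n).[(- ceil_half b)%:~R] else 0.
Proof.
rewrite phi0E.
have -> : (Jmode K (m1, m2) n k).1 (ceil_half b - ceil_half a) (hodd a, hodd b)
  = - (sd_mono k (falling K n) (m1, m2) (ceil_half b - ceil_half a)
        (hodd a, hodd b)) by [].
rewrite /sd_mono hornerN.
have -> : (ceil_half b - ceil_half a == k) && ((hodd a, hodd b) == (m1, m2))
  = (a == 2 * (ceil_half b - k) - (m1 : nat)%:Z)
     && (b == 2 * ceil_half b - (m2 : nat)%:Z).
  apply/andP/andP => [[/eqP <- /eqP[<- <-]]|[/eqP aE /eqP bE]].
    by rewrite subKr !ceil_halfK !eqxx.
  rewrite xpair_eqE aE ceil_half_half hodd_half subKr !eqxx /=.
  by rewrite bE hodd_half.
by case: ifP => // _; rewrite horner0 oppr0.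
Qed.

(** The sign (-1)^m1 is that of the action of E_ab on odd rows, and the other
    minus sign that in the definition of the modes - t^k [D]_n M_a. *)
Lemma JfieldE (m1 m2 : bool) n m v :
  Jfield F (m1, m2) n m v =
  - (-1) ^+ m1 *:
    \sum_(p < l) nprod F (plus_field m1 p) (dzn n (minus_field m2 p)) m v.
Proof.
have [N vN] := mode_term_support m1 m2 n m v.
pose k := - m - n%:Z - 1.
pose entry (j : int) := (2 * (j - k) - (m1 : nat)%:Z, 2 * j - (m2 : nat)%:Z).
have entry_inj : injective entry.
  by move=> i j [_ e]; rewrite -(ceil_half_half i m2) e ceil_half_half.
have entryE (j : int) : (entry j).1 = 2 * (j + m + n%:Z + 1) - (m1 : nat)%:Z.
  by rewrite /entry /k /=; lia.
have nprodE p : nprod F (plus_field m1 p) (dzn n (minus_field m2 p)) m v =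
    \sum_(j <- box N) mode_term m1 m2 n m p v j.
  rewrite /nprod (fsum_seq (s := [seq j + m + n%:Z | j <- box N])).
  - by rewrite big_map; apply: eq_bigr => j _; rewrite nprod_termE.
  - by rewrite map_inj_uniq ?box_uniq // => i j; lia.
  move=> e; have -> : e = e - m - n%:Z + m + n%:Z by lia.
  rewrite nprod_termE /mode_term => eN.
  rewrite vN ?scaler0 // ltnNge -mem_box; apply: contra eN => eN.
  by apply/mapP; exists (e - m - n%:Z).
under eq_bigr => p _ do rewrite nprodE.
rewrite /Jfield /sd_action /gl_action mul0r scale0r addr0.
rewrite (fsum_seq (s := map entry (box N))); last first.
- move=> [a b] abN; rewrite [(phi0hat _).1 _ _]phi0_Jmode -/k /=.
  case: ifP => [/andP[/eqP aE /eqP bE]|]; last by rewrite scale0r.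
  have abE : (a, b) = entry (ceil_half b) by rewrite /entry -aE -bE.
  rewrite abE mem_map // mem_box -ltnNge in abN.
  rewrite /Eop big1 ?scaler0 // => p _.
  have -> : a = (entry (ceil_half b)).1 by rewrite -abE.
  have -> : Osc Minus p b = Osc Minus p (2 * ceil_half b - (m2 : nat)%:Z).
    by rewrite -bE.
  by rewrite entryE vN.
- by rewrite map_inj_uniq ?box_uniq.
rewrite big_map exchange_big scaler_sumr /=; apply: eq_bigr => j _.
have := phi0_Jmode m1 m2 n k (entry j).1 (entry j).2.
rewrite /= ceil_half_half !eqxx -/k /= => ->.
rewrite /Eop hodd_half !scaleNr scalerA mulrC -scalerA.
congr (- (_ *: _)); rewrite scaler_sumr; apply: eq_bigr => p _.
by rewrite /mode_term -entryE.
Qed.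

End Fields.

Theorem proposition8p4 (R : realType) (l : nat) (hl : (1 <= l)%N)
    (F : fockSpace (R[i])%C l) :
  [/\ is_super_hom (@phi0hat (R[i])%C),
      is_super_action (fock_parity F) (gl_action F),
      is_super_action (fock_parity F) (sd_action F)
      /\ (forall v : fock_sort F,
            sd_action F (Ccentral (R[i])%C) v = l%:R *: v),
      (forall (x : sb_sort (glhat (R[i])%C)) (v : fock_sort F), sb_mem x ->
         finite_set [set ab | x.1 ab.1 ab.2 *: Eop F ab.1 ab.2 v != 0])
      /\ (forall (n : nat) (p : 'I_l),
           [/\ nprod_wd F (psi_plus p) (dzn n (psi_minus p)),
               nprod_wd F (gamma_plus p) (dzn n (gamma_minus p)),
               nprod_wd F (psi_plus p) (dzn n (gamma_minus p))
             & nprod_wd F (gamma_plus p) (dzn n (psi_minus p))])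
    & forall (n : nat) (m : int) (v : fock_sort F),
      [/\ Jfield F M0 n m v =
            - \sum_(p < l) nprod F (psi_plus p) (dzn n (psi_minus p)) m v,
          Jfield F M1 n m v =
            \sum_(p < l) nprod F (gamma_plus p) (dzn n (gamma_minus p)) m v,
          Jfield F Mp n m v =
            - \sum_(p < l) nprod F (psi_plus p) (dzn n (gamma_minus p)) m v
        & Jfield F Mm n m v =
            \sum_(p < l) nprod F (gamma_plus p) (dzn n (psi_minus p)) m v]].
Proof.
split.
- exact: phi0hat_super_hom.
- exact: gl_action_super.
- by split; [exact: sd_action_super | exact: sd_action_central].
- split=> [x v|n p]; first exact: gl_action_finite.
  by split; [exact: (nprod_wd_fields false false n p)
    | exact: (nprod_wd_fields true true n p)
    | exact: (nprod_wd_fields false true n p)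
    | exact: (nprod_wd_fields true false n p)].
move=> n m v; split; rewrite JfieldE /= ?expr0 ?expr1 ?opprK.
- by rewrite scaleN1r.
- by rewrite scale1r.
- by rewrite scaleN1r.
by rewrite scale1r.
Qed.
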